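(* Let $F$ be a graph with $\delta(F)\geqslant 1$ and let $p\in(0,1)$ be a constant. Then $\mathrm{wsat}(\mathbb{G}(n,p),F)=\mathrm{wsat}(n,F)(1+o(1))$ with high probability. That is, for every $\varepsilon>0$, the probability that $|\mathrm{wsat}(\mathbb{G}(n,p),F)-\mathrm{wsat}(n,F)|\leqslant\varepsilon\,\mathrm{wsat}(n,F)$ tends to $1$ as $n\to\infty$.
   Context: All graphs are finite, undirected, without loops or multiple edges. $\delta(F)$ is the minimum degree of $F$. For graphs $G$ and $F$, a graph $H$ is weakly $(G,F)$-saturated if $H$ is a spanning subgraph of $G$ which has no copy of $F$ as a (not necessarily induced) subgraph and there is an ordering $e_1,e_2,\dots$ of the edges in $E(G)\setminus E(H)$ such that for each $i$ the spanning subgraph of $G$ with edge set $E(H)\cup\{e_1,\dots,e_i\}$ has a copy of $F$ containing $e_i$. The weak saturation number $\mathrm{wsat}(G,F)$ is the minimum number of edges in a weakly $(G,F)$-saturated graph, and $\mathrm{wsat}(n,F)=\mathrm{wsat}(K_n,F)$, where $K_n$ is the complete graph on $n$ vertices. $\mathbb{G}(n,p)$ is the Erdős–Rényi random graph on a fixed set of $n$ vertices, where every two distinct vertices are adjacent independently with probability $p$. ''With high probability'' means with probability tending to $1$ as $n\to\infty$. The graph $F$ is fixed (independent of $n$). *)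

(* Defs.v *)
From mathcomp Require Import all_boot all_order all_algebra.

Set Implicit Arguments.
Unset Strict Implicit.
Unset Printing Implicit Defensive.

Import GRing.Theory Num.Theory.

(* A graph on the vertex set V is given by its set of edges, each edge being a
   2-element subset of V.  A spanning subgraph is thus a subset of edges. *)

Definition complete_graph (V : finType) : {set {set V}} :=
  [set e : {set V} | #|e| == 2].

Definition simple_graph (V : finType) (G : {set {set V}}) : bool :=
  G \subset complete_graph V.

Definition degree (V : finType) (G : {set {set V}}) (v : V) : nat :=
  #|[set e in G | v \in e]|.

(* Degrees of a simple graph are smaller than #|V|, so #|V| is neutral for this
   minimum; the graph without vertices gets minimum degree 0. *)
Definition min_degree (V : finType) (G : {set {set V}}) : nat :=
  \big[minn/#|V|]_(v : V) degree G v.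

Section Copies.

Variables (W V : finType) (F : {set {set W}}).

Definition copy_edges (f : {ffun W -> V}) : {set {set V}} :=
  [set f @: e | e : {set W} in F].

Definition has_copy (G : {set {set V}}) : bool :=
  [exists f : {ffun W -> V}, injectiveb f && (copy_edges f \subset G)].

Definition has_copy_containing (G : {set {set V}}) (e : {set V}) : bool :=
  [exists f : {ffun W -> V},
     [&& injectiveb f, copy_edges f \subset G & e \in copy_edges f]].

(* s enumerates the edges of G \ H without repetition; after step i (counted
   from 0) the edges added are the first i + 1 elements of s. *)
Definition saturating_order (G H : {set {set V}})
    (s : #|G :\: H|.-tuple {set V}) : bool :=
  perm_eq s (enum (G :\: H)) &&
  [forall i : 'I_#|G :\: H|,
     has_copy_containing (H :|: [set e in take i.+1 s]) (tnth s i)].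

Definition weakly_saturated (G H : {set {set V}}) : bool :=
  [&& H \subset G, ~~ has_copy H
    & [exists s : #|G :\: H|.-tuple {set V}, saturating_order s]].

(* Every H considered is contained in G, so #|G| is neutral for this minimum.
   It is a minimum over a nonempty family as soon as F has an edge, since a
   maximal F-free spanning subgraph of G is weakly saturated. *)
Definition wsat (G : {set {set V}}) : nat :=
  \big[minn/#|G|]_(H : {set {set V}} | weakly_saturated G H) #|H|.

End Copies.

Definition wsat_complete (n : nat) (W : finType) (F : {set {set W}}) : nat :=
  wsat F (complete_graph 'I_n).

Local Open Scope ring_scope.

(* Probability mass of the graph G under the law of G(n,p): the product over all
   pairs e of the Bernoulli(p) mass of the event that e is, or is not, in G. *)
Definition gnp_mass (R : numDomainType) (n : nat) (p : R)
    (G : {set {set 'I_n}}) : R :=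
  \prod_(e in complete_graph 'I_n) (if e \in G then p else 1 - p).

Definition gnp_prob (R : numDomainType) (n : nat) (p : R)
    (A : pred {set {set 'I_n}}) : R :=
  \sum_(G : {set {set 'I_n}} | simple_graph G && A G) gnp_mass p G.

(* Main.v *)
Require Import Defs.
From mathcomp Require Import all_boot all_order all_algebra.
From mathcomp Require Import zify ring lra.
From mathcomp Require all_classical all_reals all_analysis.
Set Implicit Arguments.
Unset Strict Implicit.
Unset Printing Implicit Defensive.
Import Order.TTheory GRing.Theory Num.Theory.

(** Write k for the number of vertices of F, d for its minimum degree, and a_n
    for the weak saturation number of F in K_n.  Weak saturation is a bootstrap
    process: an edge of the host graph becomes active once it completes a copy
    of F with active edges, and the weak saturation number is the least size of
    a set of edges that activates the whole host (leq_wsat, wsat_attained).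
    The engine is vertex_extension: if a clique with at least k - 1 vertices is
    active and a vertex v has d - 1 active edges to it, then all host edges from
    v to that clique become active, because v can play a vertex of F of
    minimum degree.

    Two properties of G = G(n,p) hold with high probability.  Firstly, there is
    a set K of only about the square root of n vertices, the core, such that
    every set X of boundedly many vertices has a k-clique of G inside K, disjoint
    from X and completely joined to X.  Secondly, every set of a constant fraction
    of the vertices contains an m-clique of G.  Both are union bounds: a fixed X
    or a fixed vertex set offers many candidates whose edge sets are pairwise
    disjoint, so that their failures are independent.  There are polynomially
    many sets X against about sqrt n disjoint candidates in the core, and 2^n
    vertex sets against about n^2 edge-disjoint candidates (lines in a grid).

    Lower bound.  The core makes G percolate in K_n, since every pair of
    vertices is joined to a k-clique of G.  Hence a_n <= wsat(G).

    Upper bound when d = 1.  A vertex attaches to an active clique for free, so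
    one active m-clique activates all of G (clique_spreads).  Choosing m >= k that
    minimises a_m gives wsat(G) <= a_m <= a_n, hence equality.  Nothing weaker
    would do, since a_n is bounded in this case.

    Upper bound when d >= 2.  Take all edges of G inside K, which are few.  Cover
    all but a small fraction of the other vertices by disjoint m-cliques, put an
    optimal percolating set of K_m in each, and tie each clique to a k-clique of
    the core with at most k^2 edges; tie each leftover vertex with k edges.  Then
    everything percolates (core_spreads), at a cost of about (n / m) (a_m + k^2).
    If m is a large number at which the integer part of D a_m / m is minimal,
    then a_m / m exceeds a_n / n by at most 1 / D, so the cost is
    a_n + O(n / D); and n <= 2 a_n because a percolating graph has no
    isolated vertex. *)

(** * Finite maps, minima and square roots *)

Lemma inj_into (S T : finType) (A : {set S}) (B : {set T}) (d : T) :
    #|A| <= #|B| ->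
  exists f : S -> T, {in A &, injective f} /\ {in A, forall x, f x \in B}.
Proof.
move=> leAB; pose f x := nth d (enum B) (index x (enum A)).
have ltA x : x \in A -> index x (enum A) < size (enum B).
  by move=> xA; rewrite -cardE (leq_trans _ leAB) // cardE index_mem mem_enum.
exists f; split=> [x y xA yA /eqP|x xA].
  rewrite nth_uniq ?enum_uniq ?ltA // => /eqP eqi.
  by have := congr1 (nth x (enum A)) eqi; rewrite !nth_index ?mem_enum.
by rewrite -mem_enum mem_nth ?ltA.
Qed.

Lemma bigminn_leq (I : finType) (P : pred I) (E : I -> nat) x0 j :
  P j -> \big[minn/x0]_(i | P i) E i <= E j.
Proof.
move=> Pj; exact: (Order.TotalTheory.bigmin_le_cond x0 (T := nat) E Pj).
Qed.

Lemma bigminn_attained (I : finType) (E : I -> nat) x0 :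
  let m := \big[minn/x0]_i E i in m = x0 \/ exists i, m = E i.
Proof.
move=> m; pose K x := x = x0 \/ exists i, x = E i.
rewrite -/(K _) /m; apply: big_rec => [|i x _ Kx]; first by left.
by rewrite /minn; case: ifP => // _; right; exists i.
Qed.

Lemma leq_pmul_sqr B s : 0 < B -> s <= B * s ^ 2.
Proof.
move=> B_gt0; apply: leq_trans (leq_pmull _ B_gt0).
by case: s => // s; rewrite -mulnn leq_pmulr.
Qed.

Lemma nat_sqrt_between B n : 0 < B -> exists s, B * s ^ 2 <= n < B * s.+1 ^ 2.
Proof.
move=> B_gt0; have ex0 : exists s, B * s ^ 2 <= n by exists 0%N; rewrite exp0n // muln0.
have bnd s : B * s ^ 2 <= n -> s <= n by apply/leq_trans/leq_pmul_sqr.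
case: (ex_maxnP ex0 bnd) => s sn smax; exists s; rewrite sn ltnNge.
by apply/negP => /smax; rewrite ltnn.
Qed.

Lemma nat_argmin (f : nat -> nat) (M : nat) :
  exists2 m, M <= m & forall n, M <= n -> f m <= f n.
Proof.
suff h v : forall m, M <= m -> f m <= v ->
    exists2 m, M <= m & forall n, M <= n -> f m <= f n.
  exact: (h (f M) M).
elim: v => [|v IHv] m lem fm.
  by exists m => // n _; apply: leq_trans fm _.
have [[n [len ltn]]|none] := boolp.EM (exists n, M <= n /\ f n < f m).
  by apply: (IHv n) => //; rewrite -ltnS; apply: leq_trans ltn fm.
exists m => // n len; rewrite leqNgt; apply/negP => ltn.
by apply: none; exists n.
Qed.

(** * Weak saturation as percolation *)

Section Percolation.

Variables (W : finType) (F : {set {set W}}).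

(** The sets of edges that the bootstrap process in G leaves unchanged.
    Speaking of all stable supersets of H, rather than of a final stage of the
    process started at H, spares any ordering of the added edges. *)
Definition stable (V : finType) (G A : {set {set V}}) : Prop :=
  forall e : {set V}, e \in G -> has_copy_containing F (e |: A) e -> e \in A.

Definition percolates (V : finType) (G H : {set {set V}}) : Prop :=
  forall A : {set {set V}}, H \subset A -> stable G A -> G \subset A.

Lemma percolatesS (V : finType) (G H H' : {set {set V}}) :
  H \subset H' -> percolates G H -> percolates G H'.
Proof. by move=> sHH pH A sA; apply: pH; apply: subset_trans sHH sA. Qed.

Lemma stableS (V : finType) (G G' A : {set {set V}}) :
  G' \subset G -> stable G A -> stable G' A.
Proof. by move=> sG cA e /(subsetP sG); apply: cA. Qed.

Lemma has_copy_containingP (V : finType) (G : {set {set V}}) (e : {set V}) :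
  reflect (exists f : {ffun W -> V},
    [/\ injective f, copy_edges F f \subset G & e \in copy_edges F f])
    (has_copy_containing F G e).
Proof.
apply: (iffP existsP) => [[f /and3P[/injectiveP ? ? ?]]|[f [/injectiveP ? ? ?]]].
  by exists f.
by exists f; apply/and3P.
Qed.

Lemma weakly_saturated_percolates (V : finType) (G H : {set {set V}}) :
  weakly_saturated F G H -> percolates G H.
Proof.
case/and3P=> _ _ /existsP[s /andP[sGH /forallP/= ord]] A sHA cA.
have take_sub i : i <= size s -> [set e in take i s] \subset A.
  elim: i => [|i IHi] ltis; first by rewrite take0; apply/subsetP=> e; rewrite inE.
  have lti : i < #|G :\: H| by rewrite -(size_tuple s).
  have /has_copy_containingP[f [fi fs fe]] := ord (Ordinal lti).
  pose x0 := tnth s (Ordinal lti).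
  have tE : take i.+1 s = rcons (take i s) x0.
    by rewrite (take_nth set0) // /x0 (tnth_nth set0).
  have sub : [set e in take i.+1 s] \subset x0 |: A.
    apply/subsetP=> e; rewrite tE !inE mem_rcons inE => /orP[->//|es].
    by rewrite (subsetP (IHi (ltnW ltis))) ?orbT // inE.
  have x0A : x0 \in A.
    apply: cA; last first.
      apply/has_copy_containingP; exists f; split=> //.
      apply: subset_trans fs _; rewrite subUset sub andbT.
      exact: subset_trans sHA (subsetU1 _ _).
    have : x0 \in G :\: H by rewrite -mem_enum -(perm_mem sGH) mem_tnth.
    by case/setDP.
  apply: subset_trans sub _.
  by rewrite subUset sub1set x0A subxx.
apply/subsetP=> e eG; case eH: (e \in H); first exact: subsetP eH.
apply: (subsetP (take_sub _ (leqnn _))).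
by rewrite inE take_size (perm_mem sGH) mem_enum !inE eH.
Qed.

(** Conversely, as long as an edge of G is missing, the current set is not
    stable, so that some missing edge can be added next. *)
Lemma percolates_order (V : finType) (G A : {set {set V}}) :
    A \subset G -> percolates G A ->
  exists2 s : seq {set V}, perm_eq s (enum (G :\: A)) &
    forall i, i < size s ->
      has_copy_containing F (A :|: [set e in take i.+1 s]) (nth set0 s i).
Proof.
move En : #|G :\: A| => n; elim: n A En => [|n IHn] A En sAG pA.
  exists [::] => //; rewrite (cards0_eq En); by rewrite enum_set0.
have /existsP[e /and3P[eG eA ce]] :
    [exists e, [&& e \in G, e \notin A & has_copy_containing F (e |: A) e]].
  apply: contraTT (ltn0Sn n) => /existsPn none; rewrite -En -leqNgt leqn0.
  rewrite cards_eq0 setD_eq0; apply: (pA A (subxx _)) => e eG ce.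
  by apply: contraT => eA; have := none e; rewrite eG eA ce.
have Ds : G :\: (e |: A) = (G :\: A) :\ e.
  by apply/setP=> x; rewrite !inE; case: (x == e).
have eD : e \in G :\: A by rewrite !inE eA.
have [|||s sE ord] := IHn (e |: A).
- by apply: succn_inj; rewrite Ds -En (cardsD1 e (G :\: A)) eD.
- by rewrite subUset sub1set eG.
- exact: percolatesS (subsetU1 _ _) pA.
exists (e :: s).
  apply: uniq_perm.
  - by rewrite /= (perm_mem sE) mem_enum !inE eqxx /= (perm_uniq sE) enum_uniq.
  - exact: enum_uniq.
  move=> x; rewrite inE (perm_mem sE) !mem_enum Ds [in LHS]in_setD1.
  by case: eqP => [->|]; rewrite ?eD.
case=> [_|i ltis] /=.
  suff -> : A :|: [set x in e :: take 0 s] = e |: A by [].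
  by apply/setP=> x; rewrite !inE take0 in_nil orbF orbC.
suff <- : (e |: A) :|: [set x in take i.+1 s] = A :|: [set x in e :: take i.+1 s].
  exact: ord.
by apply/setP=> x; rewrite !inE orbCA orbA.
Qed.

Lemma percolates_weakly_saturated (V : finType) (G H : {set {set V}}) :
    H \subset G -> ~~ has_copy F H -> percolates G H ->
  weakly_saturated F G H.
Proof.
move=> sHG nc pH; have [s sE ord] := percolates_order sHG pH.
have sz : size s == #|G :\: H| by rewrite (perm_size sE) -cardE.
apply/and3P; split=> //; apply/existsP; exists (Tuple sz).
apply/andP; split=> //; apply/forallP=> i; rewrite (tnth_nth set0) /=.
by apply: ord; rewrite (eqP sz).
Qed.

Hypothesis F_ne : F != set0.

(** Weakly saturated graphs must be free of F, percolating sets need not be.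
    This does not change the minimum: an edge of a copy of F inside H may be
    removed from H, because the bootstrap process immediately restores it. *)
Lemma leq_wsat (V : finType) (G H : {set {set V}}) :
  H \subset G -> percolates G H -> wsat F G <= #|H|.
Proof.
move En : #|H| => n; elim: n H En => [|n IHn] H En sHG pH;
  have [/existsP[f /andP[fi fH]]|nc] := boolP (has_copy F H).
- have [e eF] := set0Pn _ F_ne.
  have : f @: e \in H by apply: (subsetP fH); apply: imset_f.
  by rewrite (cards0_eq En) inE.
- by rewrite -En; apply: bigminn_leq; apply: percolates_weakly_saturated.
- have [e eF] := set0Pn _ F_ne.
  have feH : f @: e \in H by apply: (subsetP fH); apply: imset_f.
  apply: leq_trans (IHn (H :\ f @: e) _ _ _) (leqnSn _).
  + by apply: succn_inj; rewrite -En (cardsD1 (f @: e) H) feH.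
  + exact: subset_trans (subsetDl _ _) sHG.
  move=> A sA cA; apply: pH => //; rewrite -(setD1K feH) subUset sA andbT sub1set.
  apply: cA; first exact: (subsetP sHG).
  apply/has_copy_containingP; exists f; split; first exact/injectiveP.
    apply: subset_trans fH _; apply/subsetP=> x xH; rewrite !inE.
    by case: eqP => //= /eqP ne; apply: (subsetP sA); rewrite !inE ne.
  exact: imset_f.
- by rewrite -En; apply: bigminn_leq; apply: percolates_weakly_saturated.
Qed.

Lemma wsat_attained (V : finType) (G : {set {set V}}) :
  exists H : {set {set V}}, [/\ H \subset G, percolates G H & #|H| = wsat F G].
Proof.
pose K x := exists H : {set {set V}}, [/\ H \subset G, percolates G H & #|H| = x].
rewrite -/(K _) /wsat; apply: big_rec => [|H m wH [H' [sH' pH' eH']]].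
  by exists G; split.
rewrite /minn; case: ifP => _; last by exists H'.
exists H; split=> //; first by case/and3P: wH.
exact: weakly_saturated_percolates.
Qed.

(** What is stable in G is stable in the subgraph G' too.  So a set that activates
    G' activates, within G, first G' and then G. *)
Lemma wsat_sub (V : finType) (G G' : {set {set V}}) :
  G' \subset G -> percolates G G' -> wsat F G <= wsat F G'.
Proof.
move=> sG pG; have [H [sH pH <-]] := wsat_attained G'.
apply: leq_wsat; first by apply: subset_trans sH sG.
move=> A sA cA; apply: (pG A) => //; apply: pH => //.
exact: stableS cA.
Qed.

End Percolation.

(** * Extending a clique by a vertex *)

Lemma in_complete (V : finType) (x y : V) : ([set x; y] \in complete_graph V) = (x != y).
Proof. by rewrite inE cards2; case: (x == y). Qed.

Definition clique (V : finType) (A : {set {set V}}) (T : {set V}) : Prop :=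
  {in T &, forall x y, x != y -> [set x; y] \in A}.

Lemma cliqueS (V : finType) (A B : {set {set V}}) (T : {set V}) :
  A \subset B -> clique A T -> clique B T.
Proof. by move=> sAB cT x y xT yT ne; apply: (subsetP sAB); apply: cT. Qed.

Lemma cliqueU1 (V : finType) (A : {set {set V}}) (v : V) (T : {set V}) :
  clique A T -> {in T, forall t, [set v; t] \in A} -> clique A (v |: T).
Proof.
move=> cT vT x y; rewrite !inE.
case/predU1P=> [->|xT] /predU1P[->|yT] ne; rewrite ?eqxx // in ne *.
- exact: vT.
- by rewrite setUC; apply: vT.
- exact: cT.
Qed.

Section Extension.

Variables (W : finType) (F : {set {set W}}).
Hypotheses (F_simple : simple_graph F) (F_mindeg : 1 <= min_degree F).

Let nbr (w : W) : {set W} := [set y | [set w; y] \in F].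

Lemma nbr_neq w y : y \in nbr w -> w != y.
Proof. by rewrite inE => /(subsetP F_simple); rewrite in_complete. Qed.

Lemma edge_nbr w e : e \in F -> w \in e -> exists2 y, y \in nbr w & e = [set w; y].
Proof.
move=> eF we; have := subsetP F_simple _ eF; rewrite inE => /cards2P[x [y [ne ee]]].
move: we; rewrite ee !inE => /orP[/eqP Dw|/eqP Dw].
  by exists y; rewrite ?inE Dw -?ee.
by exists x; rewrite ?inE Dw setUC -?ee.
Qed.

Lemma degree_nbr w : degree F w = #|nbr w|.
Proof.
rewrite /degree -(card_in_imset (f := fun y => [set w; y])).
  apply: eq_card => e; rewrite inE; apply/andP/imsetP => [[eF we]|[y yN ->]].
    by have [y yN ->] := edge_nbr eF we; exists y.
  by rewrite !inE eqxx; split=> //; move: yN; rewrite inE.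
move=> y z yN zN /setP/(_ y); rewrite !inE eqxx orbT.
by rewrite eq_sym (negbTE (nbr_neq yN)) => /esym/eqP.
Qed.

Lemma degree_lt w : degree F w < #|W|.
Proof.
rewrite degree_nbr -cardsT (cardsD1 w setT) inE ltnS; apply: subset_leq_card.
by apply/subsetP=> y yN; rewrite !inE eq_sym nbr_neq.
Qed.

Lemma leq_min_degree w : min_degree F <= degree F w.
Proof. exact: bigminn_leq. Qed.

Lemma min_degree_attained : exists w, min_degree F = degree F w.
Proof.
have [m0|//] := bigminn_attained (degree F) #|W|; rewrite -/(min_degree F) in m0.
have : 0 < #|W| by rewrite -m0.
case/card_gt0P=> w _; have := leq_min_degree w; have := degree_lt w; lia.
Qed.

Lemma min_degree_lt : min_degree F < #|W|.
Proof. by have [w ->] := min_degree_attained; exact: degree_lt. Qed.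

Lemma F_neq0 : F != set0.
Proof.
have [w Dw] := min_degree_attained; move: F_mindeg; rewrite Dw => /card_gt0P[e].
by rewrite inE => /andP[eF _]; apply/set0Pn; exists e.
Qed.

Variables (V : finType) (G A : {set {set V}}).
Hypothesis A_stable : stable F G A.

(** Embed F with a vertex w of minimum degree at v, with the neighbours of w on
    u and d - 1 vertices of N, and with all other vertices anywhere else in T.
    The only edge of this copy that is possibly not active is vu. *)
Lemma vertex_extension (T N : {set V}) (v u : V) :
    clique A T -> #|W| <= #|T|.+1 -> v \notin T ->
    N \subset T -> (min_degree F).-1 <= #|N| ->
    {in N, forall x, [set v; x] \in A} ->
  u \in T -> [set v; u] \in G -> [set v; u] \in A.
Proof.
move=> cT szT vT sNT szN vN uT vuG.
have [/vN//|uN] := boolP (u \in N).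
have [N' sN' cN'] : exists2 N' : {set V}, N' \subset N & #|N'| = (min_degree F).-1.
  exists [set x in take (min_degree F).-1 (enum N)].
    by apply/subsetP=> x; rewrite inE => /mem_take; rewrite mem_enum.
  by rewrite cardsE (card_uniqP _) ?take_uniq ?enum_uniq // size_takel // -cardE.
have [w Dw] := min_degree_attained.
have uN' : u \notin N' by apply: contra uN; apply: (subsetP sN').
pose M := u |: N'.
have cM : #|M| = #|nbr w| by rewrite -degree_nbr -Dw cardsU1 uN' cN'; lia.
have sMT : M \subset T.
  by rewrite subUset sub1set uT (subset_trans sN' sNT).
pose R := ~: (w |: nbr w).
have cR : #|R| <= #|T :\: M|.
  have wn : w \notin nbr w by apply/negP => /nbr_neq; rewrite eqxx.
  rewrite cardsD (setIidPr sMT) leq_subRL ?subset_leq_card // cM -ltnS.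
  by apply: leq_trans szT; rewrite -(cardsC (w |: nbr w)) cardsU1 wn.
(* f1 is onto M by cardinality, so that some neighbour of w is sent to u. *)
have [|f1 [f1i f1M]] := inj_into (A := nbr w) (B := M) v; first by rewrite cM.
have [f2 [f2i f2M]] := inj_into v cR.
pose f := [ffun x => if x == w then v else if x \in nbr w then f1 x else f2 x].
have fw : f w = v by rewrite ffunE eqxx.
have fn x : x \in nbr w -> f x = f1 x.
  by move=> xn; rewrite ffunE xn eq_sym (negbTE (nbr_neq xn)).
have fR x : x \in R -> f x = f2 x.
  by rewrite !inE ffunE inE; case: eqP => // _; case: ifP.
have cases x : [\/ x = w, x \in nbr w | x \in R].
  rewrite [x \in R]inE in_setU1; case: (x =P w) => [->|_]; first by constructor 1.
  by case: (boolP (x \in nbr w)) => _; [constructor 2 | constructor 3].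
have fT x : x != w -> f x \in T.
  case: (cases x) => [->|xn|xR]; first by rewrite eqxx.
    by rewrite fn // => _; apply: (subsetP sMT); apply: f1M.
  by rewrite fR // => _; have := f2M _ xR; rewrite inE => /andP[].
have finj : injective f.
  have fnM x : x \in nbr w -> f x \in M by move=> xn; rewrite fn ?f1M.
  have fRM x : x \in R -> f x \notin M.
    by move=> xR; rewrite fR //; have := f2M _ xR; rewrite inE => /andP[].
  have fv x : f x = v -> x = w.
    by move=> fxv; apply/eqP; apply: contraNT vT => /fT; rewrite fxv.
  move=> x y; case: (cases x) => [->|xn|xR].
  - by rewrite fw => /esym/fv.
  - case: (cases y) => [->|yn|yR]; first by rewrite fw => /fv.
      by rewrite !fn //; apply: f1i.
    by move=> fxy; have := fRM _ yR; rewrite -fxy fnM.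
  case: (cases y) => [->|yn|yR]; first by rewrite fw => /fv.
    by move=> fxy; have := fRM _ xR; rewrite fxy fnM.
  by rewrite !fR //; apply: f2i.
apply: A_stable => //; apply/has_copy_containingP; exists f; split=> //.
  apply/subsetP=> e' /imsetP[e eF ->].
  have [we|we] := boolP (w \in e).
    have [y yn ->] := edge_nbr eF we; rewrite imsetU1 imset_set1 fw.
    have := f1M _ yn; rewrite -fn // in_setU1 => /predU1P[->|/(subsetP sN') yN].
      exact: setU11.
    by apply: setU1r; apply: vN.
  have := subsetP F_simple _ eF; rewrite inE => /cards2P[x [y [ne ee]]].
  move: we; rewrite ee !inE negb_or => /andP[wx wy].
  apply/orP; right; rewrite imsetU1 imset_set1; apply: cT; rewrite ?fT 1?eq_sym //.
  by apply: contra ne => /eqP/finj->.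
have : u \in f1 @: nbr w.
  suff -> : f1 @: nbr w = M by apply: setU11.
  apply/eqP; rewrite eqEcard card_in_imset // cM leqnn andbT.
  by apply/subsetP=> _ /imsetP[x xn ->]; apply: f1M.
case/imsetP=> y yn Du; apply/imsetP; exists [set w; y].
  by move: yn; rewrite inE.
by rewrite imsetU1 imset_set1 fw fn // -Du.
Qed.

End Extension.

(** * Graphs with a core and many cliques *)

Section Pseudorandom.

Variable V : finType.
Implicit Types (G A H : {set {set V}}) (K T X Q S : {set V}).

(** The edges whose presence makes T a clique completely joined to X.  They are
    exactly the pairs inside the union of X and T that have a vertex off X, and
    link set0 T consists of the pairs inside T. *)
Definition link X T : {set {set V}} :=
  [set e in complete_graph V | (e \subset X :|: T) && ~~ (e \subset X)].

(** K absorbs the rest of the graph: cliques found in K serve as bridges between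
    any boundedly many vertices. *)
Definition core G K k L : bool :=
  [forall X : {set V}, (#|X| <= L) ==> [exists T : {set V},
     [&& T \subset K, #|T| == k, [disjoint T & X] & link X T \subset G]]].

Definition clique_rich G m D : bool :=
  [forall S : {set V}, (#|V| <= D * #|S|) ==> [exists Q : {set V},
     [&& Q \subset S, #|Q| == m & link set0 Q \subset G]]].

Lemma in_link X T x t :
  x \in X :|: T -> t \in T -> t \notin X -> x != t -> [set x; t] \in link X T.
Proof.
move=> xXT tT tX ne; rewrite inE in_complete ne /= !subUset !sub1set xXT.
by rewrite (negbTE tX) andbF inE tT orbT.
Qed.

Lemma link_clique X T G : [disjoint T & X] -> link X T \subset G -> clique G T.
Proof.
move=> dTX sG x y xT yT ne; apply: (subsetP sG); apply: in_link => //.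
  by rewrite inE xT orbT.
by rewrite (disjointFr dTX yT).
Qed.

Lemma core_extension G K k L X : core G K k L -> #|X| <= L ->
  exists T, [/\ T \subset K, #|T| = k, clique G T, {in X, forall x, x \notin T} &
    {in X & T, forall x t, [set x; t] \in G}].
Proof.
move=> /forallP/(_ X)/implyP cG /cG /existsP[T /and4P[sTK /eqP cT dTX sG]].
exists T; split=> //; first exact: link_clique sG.
  by move=> x xX; rewrite (disjointFl dTX xX).
move=> x t xX tT; apply: (subsetP sG); apply: in_link => //.
- by rewrite inE xX.
- by rewrite (disjointFr dTX tT).
by apply: contraTneq tT => <-; rewrite (disjointFl dTX xX).
Qed.

Lemma clique_rich_clique G m D S : clique_rich G m D -> #|V| <= D * #|S| ->
  exists Q, [/\ Q \subset S, #|Q| = m & clique G Q].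
Proof.
move=> /forallP/(_ S)/implyP dG /dG /existsP[Q /and3P[sQS /eqP cQ sG]].
exists Q; split=> //; apply: link_clique sG; by rewrite disjoints_subset setC0 subsetT.
Qed.

Lemma card_edges_between S T :
  #|[set [set p.1; p.2] | p in setX S T]| <= #|S| * #|T|.
Proof. by rewrite -cardsX leq_imset_card. Qed.

Definition induced G K := [set e in G | e \subset K].

Lemma card_induced G K : simple_graph G -> #|induced G K| <= #|K| ^ 2.
Proof.
move=> sG; apply: leq_trans (card_edges_between K K); apply: subset_leq_card.
apply/subsetP=> e; rewrite inE => /andP[eG eK].
have := subsetP sG _ eG; rewrite inE => /cards2P[x [y [ne ee]]].
apply/imsetP; exists (x, y) => //; rewrite in_setX /=.
by rewrite ee subUset !sub1set in eK.
Qed.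

Lemma clique_induced G K T A :
  induced G K \subset A -> T \subset K -> clique G T -> clique A T.
Proof.
move=> sA sTK cT x y xT yT ne; apply: (subsetP sA).
by rewrite inE cT // subUset !sub1set !(subsetP sTK).
Qed.

Lemma stable_edges G A : simple_graph G ->
  (forall x y, [set x; y] \in G -> [set x; y] \in A) -> G \subset A.
Proof.
move=> sG h; apply/subsetP=> e eG; have := subsetP sG _ eG.
by rewrite inE => /cards2P[x [y [_ ee]]]; rewrite ee in eG *; apply: h.
Qed.

End Pseudorandom.

(** * Percolation in graphs with a core *)

Section Spreading.

Variables (W : finType) (F : {set {set W}}).
Hypotheses (F_simple : simple_graph F) (F_mindeg : 1 <= min_degree F).
Variables (V : finType) (G : {set {set V}}) (K : {set V}) (L : nat).
Hypothesis G_core : core G K #|W| L.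

Let extension (A G' : {set {set V}}) := @vertex_extension W F F_simple F_mindeg V G' A.
Let deg_pred_le : (min_degree F).-1 <= #|W|.
Proof. by apply: leq_trans (leq_pred _) (ltnW (min_degree_lt F_simple F_mindeg)). Qed.

(** Two vertices x and y have a k-clique T of G in common, so that vertex_extension
    applies to x and the clique made of y and T. *)
Lemma percolates_complete : 2 <= L -> percolates F (complete_graph V) G.
Proof.
move=> L2 A sGA stA; apply: stable_edges => [|x y xyC]; first exact: subxx.
have [|T [_ cT clT nT jT]] := core_extension (X := [set x; y]) G_core.
  by rewrite cards2; lia.
have clA := cliqueS sGA clT.
have jA z t : z \in [set x; y] -> t \in T -> [set z; t] \in A.
  by move=> zX tT; apply: (subsetP sGA); apply: jT.
rewrite in_complete in xyC.
apply: (extension stA (T := y |: T) (N := T)); rewrite ?in_complete ?setU11 //.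
- by apply: cliqueU1 => // t; apply: jA; rewrite !inE eqxx orbT.
- by rewrite cardsU1 cT leqW // leq_addl.
- by rewrite !inE negb_or xyC nT // !inE eqxx.
- exact: subsetU1.
- by rewrite cT.
by move=> t; apply: jA; rewrite !inE eqxx.
Qed.

Hypothesis G_simple : simple_graph G.

(** Minimum degree one means that vertices attach to active cliques for free.  The
    activity moves from Q to a k-clique T joined to Q, x and y, and from there to
    the edge xy. *)
Lemma clique_spreads (A : {set {set V}}) (Q : {set V}) :
    min_degree F = 1 -> stable F G A -> clique A Q -> #|W| <= #|Q| ->
  clique G Q -> #|Q| + 2 <= L -> G \subset A.
Proof.
move=> deg1 stA cAQ szQ cQ szL; apply: stable_edges => // x y xyG.
have xy : x != y by rewrite -in_complete; apply: (subsetP G_simple).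
have [|T [_ cT clT nT jT]] := core_extension (X := [set x; y] :|: Q) G_core.
  by have := cardsUI [set x; y] Q; rewrite cards2; lia.
have ext (T' : {set V}) v u : clique A T' -> #|W| <= #|T'|.+1 -> v \notin T' ->
    u \in T' -> [set v; u] \in G -> [set v; u] \in A.
  move=> cT' szT' vT' uT' vuG.
  by apply: (extension stA (T := T') (N := set0)); rewrite ?sub0set ?deg1 // => z; rewrite inE.
have inQ z : z \in Q -> z \in [set x; y] :|: Q by move=> zQ; rewrite inE zQ orbT.
have TQ t q : t \in T -> q \in Q -> [set t; q] \in A.
  move=> tT qQ; apply: (ext Q) => //; first lia.
    by apply: contraTN tT => tQ; rewrite nT // inQ.
  by rewrite setUC jT // inQ.
have clAT : clique A T.
  move=> t t' tT t'T ne; apply: (ext (t' |: Q)).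
  - by apply: cliqueU1 => // q; apply: TQ.
  - by rewrite (leq_trans szQ) // ltnW // ltnS subset_leq_card ?subsetU1.
  - rewrite !inE negb_or ne; apply: contraTN tT => tQ; by rewrite nT // inQ.
  - exact: setU11.
  exact: clT.
have XT z t : z \in [set x; y] -> t \in T -> [set z; t] \in A.
  move=> zX tT; have zXQ : z \in [set x; y] :|: Q by rewrite inE zX.
  by apply: (ext T); rewrite ?cT ?nT ?jT.
apply: (ext (y |: T)) => //.
- by apply: cliqueU1 => // t; apply: XT; rewrite !inE eqxx orbT.
- by rewrite (leq_trans _ (leqnSn _)) // -cT subset_leq_card ?subsetU1.
- by rewrite !inE negb_or xy nT // !inE eqxx.
exact: setU11.
Qed.

(** An anchored vertex has enough active edges to a clique of the core for
    vertex_extension to apply to it and to larger cliques of the core. *)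
Definition anchored (A : {set {set V}}) (v : V) : Prop :=
  exists S : {set V}, [/\ S \subset K, #|S| = #|W|, clique G S &
    {in S, forall s, [set v; s] \in A}].

(** Let S anchor v, and let vu be an edge with u in K.  A clique T of the core
    joined to S, v and u lets v pass from S to T, and then from T to u.  So all
    edges at the core are active; an edge between two outer vertices is then
    activated by a clique of the core that both see. *)
Lemma core_spreads (A : {set {set V}}) :
    #|W| + 2 <= L -> stable F G A -> induced G K \subset A ->
  (forall v, v \notin K -> anchored A v) -> G \subset A.
Proof.
move=> szL stA sKA anc.
have clK := clique_induced sKA.
have step1 v u : v \notin K -> u \in K -> [set v; u] \in G -> [set v; u] \in A.
  move=> vK uK vuG; have [S [sSK cS clS vS]] := anc v vK.
  have [|T [sTK cT clT nT jT]] := core_extension (X := [set v; u] :|: S) G_core.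
    by have := cardsUI [set v; u] S; rewrite cards2; lia.
  have notK (Y : {set V}) : Y \subset K -> v \notin Y.
    by move=> sYK; apply: contra vK; apply: (subsetP sYK).
  have vT t : t \in T -> [set v; t] \in A.
    move=> tT; have tTS : t |: S \subset K by rewrite subUset sub1set (subsetP sTK).
    apply: (extension stA (T := t |: S) (N := S)); rewrite ?setU11 ?subsetU1 ?notK //.
    - apply: clK => //; apply: cliqueU1 => // s sS.
      by rewrite setUC jT // inE sS orbT.
    - by rewrite -cS (leq_trans _ (leqnSn _)) // subset_leq_card ?subsetU1.
    - by rewrite cS.
    by rewrite jT // !inE eqxx.
  have uTS : u |: T \subset K by rewrite subUset sub1set uK.
  apply: (extension stA (T := u |: T) (N := T)); rewrite ?setU11 ?subsetU1 ?notK //.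
  - apply: clK => //; apply: cliqueU1 => // t tT.
    by rewrite jT // !inE eqxx orbT.
  - by rewrite -cT (leq_trans _ (leqnSn _)) // subset_leq_card ?subsetU1.
  by rewrite cT.
apply: stable_edges => // v u vuG.
have [vK|vK] := boolP (v \in K); have [uK|uK] := boolP (u \in K).
- by apply: (subsetP sKA); rewrite inE vuG subUset !sub1set vK.
- by rewrite setUC step1 // setUC.
- exact: step1.
have vu : v != u by rewrite -in_complete; apply: (subsetP G_simple).
have [|T [sTK cT clT nT jT]] := core_extension (X := [set v; u]) G_core.
  by rewrite cards2; lia.
have zT z t : z \in [set v; u] -> z \notin K -> t \in T -> [set z; t] \in A.
  by move=> zX zK tT; apply: step1; rewrite ?jT //; apply: (subsetP sTK).
apply: (extension stA (T := u |: T) (N := T)); rewrite ?setU11 ?subsetU1 //.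
- apply: cliqueU1; first exact: clK.
  by move=> t; apply: zT => //; rewrite !inE eqxx orbT.
- by rewrite -cT (leq_trans _ (leqnSn _)) // subset_leq_card ?subsetU1.
- by rewrite !inE negb_or vu nT // !inE eqxx.
- by rewrite cT.
by move=> t; apply: zT => //; rewrite !inE eqxx.
Qed.

End Spreading.

(** * Upper and lower bounds for the weak saturation number *)

Section Construction.

Variables (W : finType) (F : {set {set W}}).
Hypotheses (F_simple : simple_graph F) (F_mindeg : 1 <= min_degree F).

(** The process in a complete graph can be replayed inside a clique of G. *)
Lemma clique_transport (U V : finType) (g : U -> V) (H : {set {set U}})
    (G A : {set {set V}}) (Q : {set V}) :
    injective g -> g @: setT = Q -> percolates F (complete_graph U) H ->
    clique G Q -> stable F G A -> {in H, forall e : {set U}, g @: e \in A} ->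
  clique A Q.
Proof.
move=> gi gQ pH cQ stA HA.
pose A' := [set e : {set U} | g @: e \in A].
have gT u : g u \in Q by rewrite -gQ imset_f.
have : complete_graph U \subset A'.
  apply: pH; first by apply/subsetP=> e /HA; rewrite inE.
  move=> e eC /has_copy_containingP[f [fi fs fe]]; rewrite inE; apply: stA.
    move: eC; rewrite inE => /cards2P[x [y [ne ->]]].
    by rewrite imsetU1 imset_set1; apply: cQ; rewrite ?gT // (inj_eq gi).
  apply/has_copy_containingP; exists [ffun x => g (f x)].
  have fE (e' : {set W}) : [ffun x => g (f x)] @: e' = g @: (f @: e').
    by rewrite -imset_comp; apply: eq_imset => x; rewrite ffunE.
  split.
  - by move=> x y; rewrite !ffunE => /gi/fi.
  - apply/subsetP=> _ /imsetP[e' e'F ->]; rewrite fE.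
    have := subsetP fs (f @: e'); rewrite !inE imset_f // => /(_ isT).
    by case/predU1P=> [->|->]; rewrite ?eqxx ?orbT.
  by case/imsetP: fe => e' e'F ->; rewrite -fE imset_f.
move=> sub x y; rewrite -gQ => /imsetP[u _ ->] /imsetP[v _ ->] ne.
have : [set u; v] \in A'.
  by apply: (subsetP sub); rewrite in_complete; apply: contraNneq ne => ->.
by rewrite inE imsetU1 imset_set1.
Qed.

Variables (V : finType) (G : {set {set V}}) (K : {set V}) (L m D : nat).
Hypotheses (G_simple : simple_graph G) (G_core : core G K #|W| L).

Lemma clique_seed (Q : {set V}) : clique G Q ->
  exists H : {set {set V}}, [/\ H \subset G, #|H| <= wsat_complete #|Q| F &
    forall A : {set {set V}}, H \subset A -> stable F G A -> clique A Q].
Proof.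
move=> cQ; have [H [sH pH cH]] := wsat_attained F (complete_graph 'I_#|Q|).
pose g (i : 'I_#|Q|) := enum_val i.
have gQ : g @: setT = Q.
  apply/setP=> x; apply/imsetP/idP => [[i _ ->]|xQ]; first exact: enum_valP.
  by exists (enum_rank_in xQ x); rewrite ?inE // /g enum_rankK_in.
exists [set g @: e | e : {set 'I_#|Q|} in H]; split.
- apply/subsetP=> e' /imsetP[e /(subsetP sH)].
  rewrite inE => /cards2P[i [j [ne ->]]] ->.
  rewrite imsetU1 imset_set1; apply: cQ; rewrite ?enum_valP //.
  by apply: contraNneq ne => /enum_val_inj->.
- by rewrite /wsat_complete -cH leq_imset_card.
move=> A sHA stA; apply: (clique_transport (g := g) (H := H) _ _ _ cQ stA) => //.
  exact: enum_val_inj.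
by move=> e eH; apply: (subsetP sHA); apply: imset_f.
Qed.

Let anchors := anchored W G K.

Lemma vertex_anchor (v : V) : 1 <= L ->
  exists H : {set {set V}}, [/\ H \subset G, #|H| <= #|W| &
    forall A : {set {set V}}, H \subset A -> anchors A v].
Proof.
move=> L1; have [|S [sSK cS clS nS jS]] := core_extension (X := [set v]) G_core.
  by rewrite cards1.
exists [set [set p.1; p.2] | p in setX [set v] S]; split.
- by apply/subsetP=> _ /imsetP[[x s] /setXP[/= xX sS] ->]; apply: jS.
- by rewrite (leq_trans (card_edges_between _ _)) // cards1 cS mul1n.
move=> A sA; exists S; split=> // s sS; apply: (subsetP sA).
by apply/imsetP; exists (v, s) => //; rewrite in_setX set11.
Qed.

Lemma vertices_anchor (S : {set V}) : 1 <= L ->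
  exists H : {set {set V}}, [/\ H \subset G, #|H| <= #|S| * #|W| &
    forall A : {set {set V}}, H \subset A -> {in S, forall v, anchors A v}].
Proof.
move=> L1; move Es : #|S| => s; elim: s S Es => [|s IHs] S Es.
  exists set0; split; rewrite ?sub0set ?cards0 // (cards0_eq Es) => A _ v.
  by rewrite inE.
have [v vS] : exists v, v \in S by apply/card_gt0P; rewrite Es.
have [|H1 [sH1 c1 P1]] := IHs (S :\ v).
  by apply: succn_inj; rewrite -Es (cardsD1 v S) vS.
have [H2 [sH2 c2 P2]] := vertex_anchor v L1.
exists (H1 :|: H2); split; first by rewrite subUset sH1.
  by apply: leq_trans (leq_card_setU _ _) _; rewrite mulSn addnC leq_add.
move=> A; rewrite subUset => /andP[sA1 sA2] u uS.
have [->|uv] := eqVneq u v; first exact: P2.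
by apply: P1; rewrite // !inE uv.
Qed.

(** Once Q is active, it suffices to join d - 1 of its vertices to a clique S of
    the core: these vertices give every other vertex of Q enough active
    neighbours in the active clique that they form together with S. *)
Lemma clique_anchor (Q : {set V}) :
    clique G Q -> #|W| <= #|Q| -> #|Q| <= L -> [disjoint Q & K] ->
  exists H : {set {set V}}, [/\ H \subset G,
    #|H| <= wsat_complete #|Q| F + #|W| ^ 2 &
    forall A : {set {set V}}, H \subset A -> stable F G A -> induced G K \subset A ->
      {in Q, forall v, anchors A v}].
Proof.
move=> cQ szQ szL dQK; have [S [sSK cS clS nS jS]] := core_extension G_core szL.
have [HQ [sHQ cHQ HQP]] := clique_seed cQ.
have d1 := min_degree_lt F_simple F_mindeg.
pose T := [set x in take (min_degree F).-1 (enum Q)].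
have sTQ : T \subset Q.
  by apply/subsetP=> x; rewrite inE => /mem_take; rewrite mem_enum.
have cT : #|T| = (min_degree F).-1.
  rewrite cardsE (card_uniqP _) ?take_uniq ?enum_uniq // size_takel // -cardE; lia.
exists (HQ :|: [set [set p.1; p.2] | p in setX T S]); split.
- rewrite subUset sHQ; apply/subsetP=> _ /imsetP[[x s] /setXP[/= xT sS] ->].
  by apply: jS; rewrite ?(subsetP sTQ).
- apply: leq_trans (leq_card_setU _ _) _; apply: leq_add => //.
  apply: leq_trans (card_edges_between _ _) _.
  rewrite cS cT -mulnn leq_pmul2r; lia.
move=> A; rewrite subUset => /andP[sHA sTA] stA sKA v vQ.
have clAQ := HQP A sHA stA.
have TS t s : t \in T -> s \in S -> [set t; s] \in A.
  move=> tT sS; apply: (subsetP sTA); apply/imsetP.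
  by exists (t, s) => //; rewrite in_setX tT.
exists S; split=> // s sS.
have [/TS/(_ sS)//|vT] := boolP (v \in T).
apply: (vertex_extension F_simple F_mindeg stA (T := T :|: S) (N := T)).
- move=> x y; rewrite !in_setU => /orP[xT|xS] /orP[yT|yS] ne.
  + by apply: clAQ; rewrite ?(subsetP sTQ).
  + exact: TS.
  + by rewrite setUC TS.
  exact: (clique_induced sKA sSK clS).
- by rewrite (leq_trans _ (leqnSn _)) // -cS subset_leq_card ?subsetUr.
- by rewrite in_setU negb_or vT nS.
- exact: subsetUl.
- by rewrite cT.
- move=> t tT; apply: clAQ => //; first exact: (subsetP sTQ).
  by apply: contraNneq vT => ->.
- by rewrite in_setU sS orbT.
exact: jS.
Qed.

Hypotheses (G_rich : clique_rich G m D) (szm : #|W| <= m) (szL : m + #|W| + 2 <= L).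

(** Remove m-cliques from S greedily; t counts them, and b counts the vertices
    that are left when S has become too small to contain a further one. *)
Lemma anchor_all (S : {set V}) : [disjoint S & K] ->
  exists (H : {set {set V}}) (t b : nat), [/\ H \subset G,
    m * t + b <= #|S|, D * b <= #|V|,
    #|H| <= t * (wsat_complete m F + #|W| ^ 2) + b * #|W| &
    forall A : {set {set V}}, H \subset A -> stable F G A -> induced G K \subset A ->
      {in S, forall v, anchors A v}].
Proof.
have [s] := ubnP #|S|; elim: s S => // s IHs S; rewrite ltnS => les dSK.
have d1 := min_degree_lt F_simple F_mindeg.
have [big|small] := leqP #|V| (D * #|S|).
  have [Q [sQS cQ clQ]] := clique_rich_clique G_rich big.
  have [||H1 [t [b [sH1 c1 D1 h1 P1]]]] := IHs (S :\: Q).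
  - by apply: leq_trans les; rewrite cardsD (setIidPr sQS); have := subset_leq_card sQS; lia.
  - by apply: disjointWl dSK; apply: subsetDl.
  have [||||H2 [sH2 h2 P2]] := clique_anchor (Q := Q); rewrite ?cQ //; first lia.
    exact: disjointWl dSK.
  exists (H1 :|: H2), t.+1, b; split=> //.
  - by rewrite subUset sH1.
  - by move: c1; rewrite cardsD (setIidPr sQS); have := subset_leq_card sQS; rewrite cQ; lia.
  - apply: leq_trans (leq_card_setU _ _) _.
    by rewrite cQ in h2; rewrite mulSn; lia.
  move=> A; rewrite subUset => /andP[sA1 sA2] stA sKA v vS.
  have [vQ|vQ] := boolP (v \in Q); first exact: P2.
  by apply: P1; rewrite // inE vQ.
have [|H [sH cH PH]] := vertices_anchor S; first lia.
exists H, 0, #|S|; split=> //; first by rewrite muln0.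
  exact: ltnW.
by move=> A sA _ _; apply: PH.
Qed.

Lemma wsat_leq_core :
  exists t b, [/\ m * t <= #|V|, D * b <= #|V| &
    wsat F G <= #|K| ^ 2 + t * (wsat_complete m F + #|W| ^ 2) + b * #|W|].
Proof.
have [|H [t [b [sH c1 D1 h1 P1]]]] := anchor_all (S := ~: K).
  by rewrite disjoints_subset.
exists t, b; split=> //.
  by have := max_card (~: K); lia.
apply: leq_trans (leq_wsat (F_neq0 F_simple F_mindeg) (H := induced G K :|: H) _ _) _.
- by rewrite subUset sH andbT; apply/subsetP=> e; rewrite inE => /andP[].
- move=> A; rewrite subUset => /andP[sKA sHA] stA.
  apply: (core_spreads F_simple F_mindeg G_core G_simple _ stA sKA); first lia.
  by move=> v vK; apply: (P1 A) => //; rewrite inE.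
apply: leq_trans (leq_card_setU _ _) _.
by have := card_induced K G_simple; lia.
Qed.

Lemma wsat_leq_clique : min_degree F = 1 -> 1 <= D -> wsat F G <= wsat_complete m F.
Proof.
move=> deg1 D1; have [|Q [_ cQ clQ]] := clique_rich_clique (S := setT) G_rich.
  by rewrite cardsT leq_pmull.
have [H [sH cH HP]] := clique_seed clQ; rewrite cQ in cH.
apply: leq_trans cH; apply: (leq_wsat (F_neq0 F_simple F_mindeg)) => // A sHA stA.
have := clique_spreads F_simple F_mindeg G_core G_simple deg1 stA (HP A sHA stA).
by rewrite cQ; apply=> //; lia.
Qed.

Lemma wsat_complete_leq : wsat F (complete_graph V) <= wsat F G.
Proof.
have L2 : 2 <= L by lia.
have pG := percolates_complete F_simple F_mindeg G_core L2.
exact: (wsat_sub (F_neq0 F_simple F_mindeg) (G_simple : G \subset complete_graph V) pG).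
Qed.

End Construction.

(** A vertex v without an edge of H stays isolated forever: the first edge
    added at v would be the only edge at v in a copy of F, although every vertex
    of F has degree at least two. *)
Lemma wsat_complete_ge (W : finType) (F : {set {set W}}) n :
  simple_graph F -> 2 <= min_degree F -> 2 <= n -> n <= 2 * wsat_complete n F.
Proof.
move=> sF dF n2; rewrite /wsat_complete.
have [H [sH pH <-]] := wsat_attained F (complete_graph 'I_n).
have cov : cover H = setT.
  apply/eqP; rewrite eqEsubset subsetT; apply/subsetP=> v _.
  apply: contraT => vH; pose A := [set e in complete_graph 'I_n | v \notin e].
  have sHA : H \subset A.
    apply/subsetP=> e eH; rewrite inE (subsetP sH) //=.
    by apply: contra vH => ve; apply/bigcupP; exists e.
  have stA : stable F (complete_graph 'I_n) A.
    move=> e eC /has_copy_containingP[f [fi fs /imsetP[e1 e1F De]]].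
    rewrite inE eC /= De; apply/negP => /imsetP[w we1 Dv].
    have : 1 < #|[set e in F | w \in e]| by apply: leq_trans dF _; apply: bigminn_leq.
    rewrite (cardsD1 e1) inE e1F we1 ltnS => /card_gt0P[e2].
    rewrite !inE => /and3P[ne21 e2F we2].
    have := subsetP fs (f @: e2); rewrite imset_f // !inE => /(_ isT).
    rewrite {1}De Dv imset_f // andbF orbF => /eqP/(imset_inj fi) e21.
    by rewrite e21 eqxx in ne21.
  have [u uv] : exists u, u != v.
    have : 0 < #|[set~ v]| by rewrite cardsC1 card_ord; lia.
    by case/card_gt0P=> u; rewrite !inE; exists u.
  have := subsetP (pH A sHA stA) [set u; v]; rewrite in_complete uv => /(_ isT).
  by rewrite !inE eqxx orbT andbF.
have := leq_card_cover H; rewrite cov cardsT card_ord => /leq_trans; apply.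
rewrite mulnC -sum_nat_const; apply: leq_sum => e /(subsetP sH).
by rewrite inE => /eqP->.
Qed.

(** The deterministic heart: for D0 large, the second inequality is
    wsat(G) <= (1 + 8 / D0) a_n.  For d >= 2 the eight comes from the error term
    4 n: the core, the k^2 ties per clique, the ties of leftover vertices and the
    rounding of D0 a_m / m contribute n each (after multiplication by D0), and
    n <= 2 a_n. *)
Lemma wsat_core_clique_rich (W : finType) (F : {set {set W}}) (D0 : nat) :
    simple_graph F -> 1 <= min_degree F -> 0 < D0 ->
  exists L m D n0, [/\ 0 < m, 0 < D &
    forall n (K : {set 'I_n}) (G : {set {set 'I_n}}),
      n0 <= n -> simple_graph G -> D * #|K| ^ 2 <= n ->
      core G K #|W| L -> clique_rich G m D ->
    wsat_complete n F <= wsat F G /\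
    D0 * wsat F G <= (D0 + 8) * wsat_complete n F].
Proof.
move=> sF dF D0_gt0; have W_gt0 : 0 < #|W| by have := min_degree_lt sF dF; lia.
have [deg1|deg2] : min_degree F = 1 \/ 2 <= min_degree F by lia.
  have [m lem mP] := nat_argmin (fun n => wsat_complete n F) #|W|.
  exists (m + #|W| + 2), m, 1, #|W|; split=> //; first exact: leq_trans lem.
  move=> n K G len sG _ cG dG.
  have low := wsat_complete_leq sF dF sG cG dG lem (leqnn _).
  have up := wsat_leq_clique sF dF sG cG dG lem (leqnn _) deg1 isT.
  split=> //; have := mP n len; rewrite /= => mn.
  by rewrite leq_mul ?leq_addr //; apply: leq_trans up mn.
(* Cliques of this size make k^2 ties per clique cost at most n / D0 in all. *)
pose M := #|W| ^ 2 * D0 + #|W|.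
have [m lem mP] := nat_argmin (fun n => (D0 * wsat_complete n F) %/ n) M.
have Wm : #|W| <= m by apply: leq_trans lem; apply: leq_addl.
have m_gt0 : 0 < m by apply: leq_trans Wm.
exists (m + #|W| + 2), m, (D0 * #|W|), (M + 2); split=> //.
  by rewrite muln_gt0 D0_gt0.
move=> n K G len sG cK cG dG.
have low := wsat_complete_leq sF dF sG cG dG Wm (leqnn _).
split=> //.
have [t [b [tn bn up]]] := wsat_leq_core sF dF sG cG dG Wm (leqnn _).
rewrite card_ord in tn bn.
have an : n <= 2 * wsat_complete n F by apply: wsat_complete_ge => //; lia.
have n_gt0 : 0 < n by lia.
have /mP/= mn : M <= n by lia.
have am : t * (D0 * wsat_complete m F) <= D0 * wsat_complete n F + n.
  have /ltnW am := ltn_ceil (D0 * wsat_complete m F) m_gt0.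
  have ann := leq_trunc_div (D0 * wsat_complete n F) n.
  apply: leq_trans (leq_mul (leqnn t) am) _.
  rewrite mulnCA; apply: (@leq_trans ((D0 * wsat_complete n F %/ n).+1 * n)).
    by rewrite leq_mul // [t * m]mulnC.
  by rewrite mulSn addnC leq_add2r.
have kb : D0 * (b * #|W|) <= n by move: bn; rewrite mulnAC mulnA.
have kK : D0 * #|K| ^ 2 <= n.
  by apply: leq_trans cK; rewrite leq_mul2r; apply/orP; right; rewrite leq_pmulr.
have kt : D0 * (t * #|W| ^ 2) <= n.
  apply: leq_trans tn; rewrite mulnCA mulnC leq_mul2r mulnC.
  by rewrite (leq_trans _ lem) ?orbT // leq_addr.
move: up; rewrite -(leq_pmul2l D0_gt0) => up; apply: leq_trans up _.
move: am kb kK kt; rewrite !mulnDr !mulnDl [t * (D0 * _)]mulnCA; lia.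
Qed.

(** * Packings of small sets *)

Section Packings.

Variable V : finType.
Implicit Types (S T X : {set V}).

Lemma disjoint_subsets k t S : t * k <= #|S| ->
  exists s : seq {set V}, [/\ size s = t,
    {in s, forall T : {set V}, T \subset S /\ #|T| = k} &
    pairwise (fun T T' : {set V} => [disjoint T & T']) s].
Proof.
elim: t S => [|t IHt] S leS; first by exists [::].
pose T := [set x in take k (enum S)].
have sTS : T \subset S by apply/subsetP=> x; rewrite inE => /mem_take; rewrite mem_enum.
have cT : #|T| = k.
  rewrite cardsE (card_uniqP _) ?take_uniq ?enum_uniq // size_takel // -cardE; lia.
have [|s [sz sP sD]] := IHt (S :\: T).
  by rewrite cardsD (setIidPr sTS) cT; lia.
exists (T :: s); split=> /=; first by rewrite sz.
  move=> T'; rewrite inE => /predU1P[->//|/sP[sT' ?]]; split=> //.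
  exact: subset_trans sT' (subsetDl _ _).
rewrite sD andbT; apply/allP=> T' /sP[sT' _].
by rewrite disjoint_sym; move: sT'; rewrite subsetD => /andP[].
Qed.

(** An edge in both sets would have a vertex off X in both T and T'. *)
Lemma disjoint_link X T T' :
  [disjoint T & T'] -> [disjoint link X T & link X T'].
Proof.
move=> dT; rewrite -setI_eq0; apply/eqP/setP=> e; rewrite !inE.
apply/negbTE/negP => /andP[/and3P[_ eT /subsetPn[x xe xX]] /and3P[_ eT' _]].
have := subsetP eT x xe; have := subsetP eT' x xe.
rewrite !inE (negbTE xX) /= => xT' xT.
by rewrite (disjointFr dT xT) in xT'.
Qed.

Lemma card_link X T : #|link X T| <= 2 ^ (#|X| + #|T|).
Proof.
apply: (@leq_trans (2 ^ #|X :|: T|)); last by rewrite leq_exp2l // leq_card_setU.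
rewrite -card_powerset; apply: subset_leq_card; apply/subsetP=> e.
by rewrite inE powersetE => /and3P[].
Qed.

Lemma link_complete X T : link X T \subset complete_graph V.
Proof. by apply/subsetP=> e; rewrite inE => /andP[]. Qed.

Lemma card_small_sets L : #|[set X : {set V} | #|X| <= L]| <= #|V|.+1 ^ L.
Proof.
elim: L => [|L IHL].
  rewrite expn0 -(cards1 (set0 : {set V})); apply: subset_leq_card.
  by apply/subsetP=> X; rewrite !inE leqn0 cards_eq0.
pose add (q : option V * {set V}) := if q.1 is Some x then x |: q.2 else q.2.
apply: (@leq_trans #|add @: setX setT [set X : {set V} | #|X| <= L]|).
  apply: subset_leq_card; apply/subsetP=> X; rewrite inE => cX.
  have [->|[x xX]] := set_0Vmem X.
    by apply/imsetP; exists (None, set0) => //; rewrite in_setX !inE cards0.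
  apply/imsetP; exists (Some x, X :\ x); last by rewrite /add /= setD1K.
  by rewrite in_setX !inE /=; move: cX; rewrite (cardsD1 x) xX.
apply: leq_trans (leq_imset_card _ _) _.
by rewrite cardsX cardsT card_option expnS leq_mul2l IHL orbT.
Qed.

Lemma line_lt m N (ab : 'I_N * 'I_N) (i : 'I_m) : ab.1 * i + ab.2 < m * N.
Proof. by case: ab i => [[a la] [b lb]] [i li] /=; nia. Qed.

(** Place an m by m N grid in S, and take the N^2 lines y = a x + b with a, b < N.
    Two of them share at most one grid point, hence no pair of vertices. *)
Lemma edge_disjoint_subsets m N S : 0 < m -> m ^ 2 * N <= #|S| ->
  exists s : seq {set V}, [/\ size s = N ^ 2,
    {in s, forall T : {set V}, T \subset S /\ #|T| = m} &
    pairwise (fun T T' : {set V} => [disjoint link set0 T & link set0 T']) s].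
Proof.
move=> m_gt0 leS; have [->|N_gt0] := posnP N; first by exists [::].
have [d dS] : exists d, d \in S.
  by apply/card_gt0P; apply: leq_trans leS; rewrite muln_gt0 expn_gt0 m_gt0.
have [|g [giT gS]] := @inj_into _ _ [set: 'I_m * 'I_(m * N)] S d.
  by rewrite cardsT card_prod !card_ord mulnA mulnn.
have gi : injective g by move=> x y; apply: giT; rewrite inE.
pose pt ab i := g (i, Ordinal (line_lt ab i)).
have pt_inj ab cd i j : pt ab i = pt cd j ->
    i = j /\ ab.1 * i + ab.2 = cd.1 * j + cd.2.
  by move/gi=> [-> ->].
pose line ab : {set V} := pt ab @: setT.
exists [seq line ab | ab <- enum {: 'I_N * 'I_N}]; split.
- by rewrite size_map -cardE card_prod card_ord mulnn.
- move=> T /mapP[ab _ ->]; split.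
    by apply/subsetP=> x /imsetP[i _ ->]; apply: gS; rewrite inE.
  rewrite card_imset ?cardsT ?card_ord // => i j /pt_inj[].
  by [].
rewrite pairwise_map; have := enum_uniq {: 'I_N * 'I_N}; rewrite uniq_pairwise.
apply: sub_pairwise => ab cd /=; apply: contraR.
rewrite -setI_eq0 => /set0Pn[e]; rewrite !inE !set0U.
case/andP=> /and3P[/cards2P[x [y [ne ->]]] + _] /and3P[_ + _].
rewrite !subUset !sub1set => /andP[/imsetP[i _ Dx] /imsetP[j _ Dy]].
case/andP=> /imsetP[i' _] + /imsetP[j' _].
rewrite Dx Dy => /pt_inj[<- Ei] /pt_inj[<- Ej].
have ij : i != j :> nat by apply: contraNneq ne => /val_inj ij; rewrite Dx Dy ij.
rewrite {Dx Dy ne}; case: ab cd Ei Ej => [[a la] [b lb]] [[c lc] [f lf]] /= Ei Ej.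
have [ac bf] : a = c /\ b = f by nia.
by apply/eqP; congr (_, _); apply: val_inj.
Qed.

End Packings.

Local Open Scope ring_scope.

(** * Random subsets of a finite set *)

Section RandomSubset.

Variables (R : realFieldType) (p : R) (T : finType).
Hypotheses (p_ge0 : 0 <= p) (p_le1 : p <= 1).
Implicit Types (B E G : {set T}) (P Q : pred {set T}).

(** The law of the random subset of B that keeps each element of B independently
    with probability p. *)
Definition mass B G : R := \prod_(e in B) (if e \in G then p else 1 - p).

Definition prob B P : R := \sum_(G : {set T} | (G \subset B) && P G) mass B G.

Lemma mass_ge0 B G : 0 <= mass B G.
Proof. by apply: prodr_ge0 => e _; case: ifP; rewrite ?subr_ge0. Qed.

Lemma eq_prob B P Q : {in powerset B, P =1 Q} -> prob B P = prob B Q.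
Proof.
move=> ePQ; apply: eq_bigl => G; case GB: (G \subset B) => //=.
by rewrite ePQ ?powersetE.
Qed.

(** A subset of B is a pair of a subset of E and a subset of the rest of B, and its
    mass is the product of theirs. *)
Lemma prob_indep B E P Q : E \subset B ->
  prob B (fun G => P (G :&: E) && Q (G :\: E)) = prob E P * prob (B :\: E) Q.
Proof.
move=> sEB; rewrite /prob big_distrlr pair_big /=.
rewrite (reindex_onto (fun q : {set T} * {set T} => q.1 :|: q.2)
           (fun G => (G :&: E, G :\: E))) /=; last by move=> G _; rewrite setID.
have decomp (G1 G2 : {set T}) : G1 \subset E -> G2 \subset B :\: E ->
    (G1 :|: G2) :&: E = G1 /\ (G1 :|: G2) :\: E = G2.
  rewrite subsetD => sG1 /andP[sG2 dG2]; rewrite setIUl setDUl.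
  rewrite (setIidPl sG1) (disjoint_setI0 dG2) setU0; split=> //.
  by rewrite (setDidPl dG2) (eqP (_ : G1 :\: E == set0)) ?set0U // setD_eq0.
apply: eq_big => [[G1 G2]|[G1 G2] /=].
  rewrite /= xpair_eqE; apply/idP/idP.
    case/and3P=> /and3P[sB P1 Q2] /eqP D1 /eqP D2.
    have s1 : G1 \subset E by rewrite -D1 subsetIr.
    have s2 : G2 \subset B :\: E by rewrite -D2 setSD.
    by move: P1 Q2; rewrite D1 D2 s1 s2 => -> ->.
  case/andP=> /andP[s1 P1] /andP[s2 Q2]; have [-> ->] := decomp _ _ s1 s2.
  rewrite P1 Q2 !eqxx !andbT subUset (subset_trans s1 sEB).
  exact: subset_trans s2 (subsetDl _ _).
rewrite xpair_eqE => /and3P[_ /eqP D1 /eqP D2].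
rewrite /mass (big_setID E) (setIidPr sEB) /=; congr (_ * _); apply: eq_bigr => e.
  by move=> eE; rewrite -{2}D1 !inE eE andbT.
by rewrite inE => /andP[eE _]; rewrite -{2}D2 [in RHS]inE eE.
Qed.

(** Expand the product over B of p + (1 - p). *)
Lemma prob_full B : prob B predT = 1.
Proof.
pose f e : R := if e \in B then p else 0.
pose g e : R := if e \in B then 1 - p else 1.
have : \prod_e (f e + g e) = 1.
  by apply: big1 => e _; rewrite /f /g; case: ifP => _; rewrite ?add0r // subrKC.
rewrite bigA_distr => <-; rewrite [RHS](bigID (fun J : {set T} => J \subset B)) /=.
rewrite [X in _ = _ + X]big1 ?addr0.
  apply: eq_big => [G|G GB]; first by rewrite andbT.
  rewrite /mass big_mkcond; apply: eq_bigr => e _; rewrite /f /g.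
  have [eG|eG] := boolP (e \in G); last by [].
  by rewrite (subsetP (_ : G \subset B)) //; rewrite andbT in GB.
move=> J /subsetPn[e eJ eB]; rewrite (bigD1 e) //= eJ /f (negbTE eB).
by rewrite mul0r.
Qed.

Lemma prob_mono B P Q : (forall G, G \subset B -> P G -> Q G) -> prob B P <= prob B Q.
Proof.
move=> sPQ; rewrite /prob big_mkcond [X in _ <= X]big_mkcond /=.
apply: ler_sum => G _; case: (boolP (G \subset B)) => //= GB.
case PG: (P G); first by rewrite sPQ.
by case: ifP => _; rewrite ?mass_ge0.
Qed.

Lemma prob_le1 B P : prob B P <= 1.
Proof. by rewrite -(prob_full B); apply: prob_mono. Qed.

Lemma prob_not B P : prob B (fun G => ~~ P G) = 1 - prob B P.
Proof.
apply/eqP; rewrite -subr_eq0 opprB addrA subr_eq0 addrC -(prob_full B) /prob.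
rewrite [X in _ == X](bigID P) /=; apply/eqP.
by congr (_ + _); apply: eq_bigl => G; rewrite andbT.
Qed.

Lemma prob_exists (I : finType) (C : pred I) B (P : I -> pred {set T}) :
  prob B (fun G => [exists i, C i && P i G]) <= \sum_(i | C i) prob B (P i).
Proof.
rewrite /prob (exchange_big_dep (fun G => G \subset B)) => [|i G _ /andP[]//].
rewrite big_mkcondr; apply: ler_sum => G GB; case: existsP => [[i /andP[Ci PG]]|_].
  rewrite (bigD1 i) ?Ci ?GB //= lerDl.
  by apply: sumr_ge0 => j _; apply: mass_ge0.
by apply: sumr_ge0 => j _; apply: mass_ge0.
Qed.

Lemma prob_all_in B : prob B (fun G => B \subset G) = p ^+ #|B|.
Proof.
rewrite /prob (big_pred1 B) => [|G]; last by rewrite /= eqEsubset.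
by rewrite /mass (eq_bigr (fun=> p)) ?prodr_const // => e ->.
Qed.

(** Split off one set at a time by prob_indep: whether the random set contains the
    others only depends on its part outside the first one. *)
Lemma prob_none (s : seq {set T}) B :
    pairwise (fun E E' : {set T} => [disjoint E & E']) s ->
    all (fun E => E \subset B) s ->
  prob B (fun G => all (fun E => ~~ (E \subset G)) s) =
    \prod_(E <- s) (1 - p ^+ #|E|).
Proof.
elim: s B => [|E s IHs] B /=; first by move=> _ _; rewrite big_nil prob_full.
case/andP=> /allP dE dis /andP[sEB /allP sB].
rewrite big_cons -(IHs (B :\: E)) //; last first.
  apply/allP=> E' E's; rewrite subsetD sB //= disjoint_sym; exact: dE.
rewrite -prob_all_in -prob_not.
rewrite -(prob_indep (fun G => ~~ (E \subset G))
  (fun G => all (fun E => ~~ (E \subset G)) s) sEB).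
apply: eq_prob => G _; rewrite subsetI subxx andbT; congr (_ && _).
apply: eq_in_all => E' E's; rewrite subsetD.
by have /dE := E's; rewrite disjoint_sym => ->; rewrite andbT.
Qed.

Lemma prob_none_leq (s : seq {set T}) B M :
    pairwise (fun E E' : {set T} => [disjoint E & E']) s ->
    all (fun E => (E \subset B) && (#|E| <= M)%N) s ->
  prob B (fun G => all (fun E => ~~ (E \subset G)) s) <= (1 - p ^+ M) ^+ size s.
Proof.
move=> dis; rewrite all_predI => /andP[sB sM]; rewrite prob_none //.
elim: s sM {dis sB} => [|E s IHs] /=; first by rewrite big_nil expr0.
case/andP=> EM sM; rewrite big_cons exprS; apply: ler_pM.
- by rewrite subr_ge0 exprn_ile1.
- by apply: prodr_ge0 => E' _; rewrite subr_ge0 exprn_ile1.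
- by rewrite lerD2l lerN2; apply: ler_wiXn2l.
exact: IHs.
Qed.

End RandomSubset.

(** * Random graphs have a core and many cliques *)

Section FailureProbability.

Variables (R : realFieldType) (p : R) (V : finType).
Hypotheses (p_ge0 : 0 <= p) (p_le1 : p <= 1).

Let P := prob p (complete_graph V).

Lemma prob_no_link (X : {set V}) (s : seq {set V}) M :
    pairwise (fun T T' : {set V} => [disjoint link X T & link X T']) s ->
    {in s, forall T : {set V}, (#|X| + #|T| <= M)%N} ->
  P (fun G => all (fun T => ~~ (link X T \subset G)) s)
    <= (1 - p ^+ (2 ^ M)) ^+ size s.
Proof.
move=> dis sM; rewrite -(size_map (link X)).
apply: le_trans (prob_none_leq (B := complete_graph V) p_ge0 p_le1 (M := 2 ^ M) _ _).
- by rewrite le_eqVlt; apply/orP; left; apply/eqP/eq_prob => G _; rewrite all_map.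
- by rewrite pairwise_map.
apply/allP=> _ /mapP[T Ts ->]; rewrite link_complete /=.
by apply: leq_trans (card_link _ _) _; rewrite leq_exp2l // sM.
Qed.

(** The factor in front bounds the number of sets X, and the t candidates for T are
    disjoint k-subsets of K away from X. *)
Lemma prob_not_core (K : {set V}) (k L t : nat) : (t * k + L <= #|K|)%N ->
  P (fun G => ~~ core G K k L)
    <= (#|V|.+1 ^ L)%:R * (1 - p ^+ (2 ^ (L + k))) ^+ t.
Proof.
move=> tkL; set q := _ ^+ t.
pose bad (X : {set V}) (G : {set {set V}}) := [forall T : {set V},
  ~~ [&& T \subset K, #|T| == k, [disjoint T & X] & link X T \subset G]].
have badX (X : {set V}) : (#|X| <= L)%N -> P (bad X) <= q.
  move=> cX; have [|s [sz sP sD]] := @disjoint_subsets V k t (K :\: X).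
    by rewrite cardsD; have := subset_leq_card (subsetIr K X); lia.
  rewrite /q -sz; apply: le_trans (@prob_no_link X s _ _ _).
  - apply: prob_mono => // G _ /forallP bG; apply/allP=> T Ts.
    have := bG T; have [sT cT] := sP T Ts; move: sT; rewrite subsetD => /andP[-> ->].
    by rewrite cT eqxx.
  - by apply: sub_pairwise sD => T T'; apply: disjoint_link.
  by move=> T /sP[_ ->]; rewrite leq_add2r.
apply: (@le_trans _ _ (P (fun G => [exists X : {set V}, (#|X| <= L)%N && bad X G]))).
  apply: prob_mono => // G _; rewrite negb_forall => /existsP[X].
  rewrite negb_imply negb_exists => bX; by apply/existsP; exists X.
apply: le_trans (prob_exists p_ge0 p_le1 _ _ _) _.
apply: (@le_trans _ _ (\sum_(X : {set V} | (#|X| <= L)%N) q)).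
  by apply: ler_sum => X; apply: badX.
rewrite sumr_const -[q *+ _]mulr_natl ler_wpM2r ?ler_nat //.
  by rewrite /q exprn_ge0 // subr_ge0 exprn_ile1.
apply: leq_trans (card_small_sets V L).
by apply: subset_leq_card; apply/subsetP=> X; rewrite !inE.
Qed.

(** The factor in front bounds the number of vertex sets S, and the N^2 candidates for an
    m-clique in S share no edges. *)
Lemma prob_not_clique_rich (m D N : nat) : (0 < m)%N -> (0 < D)%N ->
    (D * (m ^ 2 * N) <= #|V|)%N ->
  P (fun G => ~~ clique_rich G m D)
    <= (2 ^ #|V|)%:R * (1 - p ^+ (2 ^ m)) ^+ (N ^ 2).
Proof.
move=> m_gt0 D_gt0 leN; set q := _ ^+ _.
pose bad (S : {set V}) (G : {set {set V}}) := [forall Q : {set V},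
  ~~ [&& Q \subset S, #|Q| == m & link set0 Q \subset G]].
have badS (S : {set V}) : (#|V| <= D * #|S|)%N -> P (bad S) <= q.
  move=> cS; have [|s [sz sP sD]] := @edge_disjoint_subsets V m N S m_gt0.
    by rewrite -(leq_pmul2l D_gt0) (leq_trans leN).
  rewrite /q -sz; apply: le_trans (@prob_no_link set0 s _ sD _).
  - apply: prob_mono => // G _ /forallP bG; apply/allP=> T Ts.
    by have := bG T; have [-> ->] := sP T Ts; rewrite eqxx.
  by move=> T /sP[_ ->]; rewrite cards0.
apply: (@le_trans _ _ (P (fun G => [exists S : {set V}, (#|V| <= D * #|S|)%N && bad S G]))).
  apply: prob_mono => // G _; rewrite negb_forall => /existsP[S].
  rewrite negb_imply negb_exists => bS; by apply/existsP; exists S.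
apply: le_trans (prob_exists p_ge0 p_le1 _ _ _) _.
apply: (@le_trans _ _ (\sum_(S : {set V} | (#|V| <= D * #|S|)%N) q)).
  by apply: ler_sum => X; apply: badS.
rewrite sumr_const -[q *+ _]mulr_natl ler_wpM2r ?ler_nat //.
  by rewrite /q exprn_ge0 // subr_ge0 exprn_ile1.
rewrite -cardsT -card_powerset; apply: subset_leq_card; apply/subsetP=> X _.
by rewrite powersetE subsetT.
Qed.

End FailureProbability.

Section Asymptotics.

Variable R : archiRealFieldType.

Lemma eventually_large (C eta : R) : 0 < eta ->
  exists s0, forall s, (s0 <= s)%N -> C <= eta * s%:R.
Proof.
move=> eta_gt0; exists (Num.bound `|C / eta|) => s les.
rewrite mulrC -ler_pdivrMr // (le_trans (ler_norm _)) //.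
apply: le_trans (ltW (archi_boundP (normr_ge0 _))) _.
by rewrite ler_nat.
Qed.

(** A form of Bernoulli's inequality, strong enough for all decay estimates
    below: it bounds (1 - q)^s by 1 / (s q), hence (1 - q)^(J s) by the J-th power
    of that, which beats any polynomial in s of degree below J. *)
Lemma expr_1B_leq (q : R) s : 0 <= q <= 1 -> (1 - q) ^+ s * (s%:R * q) <= 1.
Proof.
case/andP=> q_ge0 q_le1; have q1 : 0 <= 1 - q by rewrite subr_ge0.
suff h : (1 - q) ^+ s * (1 + s%:R * q) <= 1.
  by apply: le_trans h; rewrite ler_wpM2l ?exprn_ge0 // lerDr.
elim: s => [|s IHs]; first by rewrite mul0r addr0 mulr1.
apply: le_trans IHs; rewrite exprSr -mulrA ler_wpM2l ?exprn_ge0 //.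
rewrite -natr1; have : 0 <= s%:R * q ^+ 2 :> R by rewrite mulr_ge0 ?sqr_ge0.
have := sqr_ge0 q; lra.
Qed.

Lemma expr_1B_small (q eta : R) : 0 < q <= 1 -> 0 < eta ->
  exists s0, forall s, (s0 <= s)%N -> (1 - q) ^+ s <= eta.
Proof.
move=> /andP[q_gt0 q_le1] eta_gt0.
have [s0 s0P] := eventually_large 1 (mulr_gt0 eta_gt0 q_gt0).
exists s0.+1 => s les; have sq : 0 < s%:R * q :> R by rewrite mulr_gt0 // ltr0n; lia.
rewrite -(ler_pM2r sq); apply: le_trans (expr_1B_leq _ _) _; first by rewrite ltW.
by have := s0P s (ltnW les); rewrite mulrAC mulrA.
Qed.

(** The exponent is quadratic in n, so it exceeds a n for any constant a; choose
    a such that (1 - q)^a <= 1/4, which beats the factor 2^n. *)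
Lemma clique_rich_rate (q eta : R) (C : nat) : 0 < q <= 1 -> 0 < eta -> (0 < C)%N ->
  exists n0, forall n, (n0 <= n)%N ->
    (2 ^ n)%:R * (1 - q) ^+ ((n %/ C) ^ 2) <= eta.
Proof.
move=> q01 eta_gt0 C_gt0; have /andP[q_gt0 q_le1] := q01.
have q1 : 0 <= 1 - q by rewrite subr_ge0.
have [||a aP] := @expr_1B_small q (1 / 4) => //; first by lra.
have [||n1 n1P] := @expr_1B_small (1 / 2) eta => //; first by apply/andP; split; lra.
exists (n1 + 2 * a * C * C + C)%N => n len.
have aN : (a * n <= (n %/ C) ^ 2)%N.
  have := divn_eq n C; have := ltn_pmod n C_gt0.
  have : (2 * a * C <= n %/ C)%N.
    by rewrite leq_divRL //; lia.
  have : (0 < n %/ C)%N by rewrite divn_gt0 //; lia.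
  set N := (n %/ C)%N; nia.
apply: (@le_trans _ _ ((2 ^ n)%:R * (1 / 4) ^+ n)).
  rewrite ler_wpM2l ?ler0n //.
  apply: (@le_trans _ _ ((1 - q) ^+ (a * n))).
    by apply: ler_wiXn2l => //; rewrite lerBlDr lerDl ltW.
  by rewrite exprM lerXn2r ?nnegrE ?exprn_ge0 ?aP //; lra.
rewrite natrX -exprMn (_ : 2%:R * (1 / 4) = 1 - 1 / 2 :> R); last by lra.
by apply: n1P; lia.
Qed.

(** As n is at most of order s^2, the polynomial (n + 1)^L is of order s^(2 L),
    whereas the power of 1 - q decays like s^-(2 L + 1) or faster. *)
Lemma core_rate (q eta : R) (L B : nat) : 0 < q <= 1 -> 0 < eta ->
  exists s0, forall s n, (s0 <= s)%N -> (n < B * s.+1 ^ 2)%N ->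
    (n.+1 ^ L)%:R * (1 - q) ^+ (s * (2 * L + 1)) <= eta.
Proof.
move=> /andP[q_gt0 q_le1] eta_gt0; set J := (2 * L + 1)%N.
have q1 : 0 <= 1 - q by rewrite subr_ge0.
have [s0 s0P] := eventually_large ((4 * B) ^ L)%:R (mulr_gt0 eta_gt0 (exprn_gt0 J q_gt0)).
exists s0.+1 => s n les ltn; have s_gt0 : 0 < s%:R :> R by rewrite ltr0n; lia.
have nB : (n.+1 ^ L <= (4 * B) ^ L * s ^ (2 * L))%N.
  rewrite expnM -expnMn; case: (posnP L) => [->|L_gt0]; first by rewrite !expn0.
  rewrite leq_exp2r // (leq_trans ltn) // [(4 * B)%N]mulnC -mulnA (_ : 4 = 2 ^ 2)%N //.
  by rewrite -expnMn leq_mul2l leq_exp2r // mul2n -addnn; lia.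
rewrite -(ler_pM2r s_gt0) -(ler_pM2r (exprn_gt0 J q_gt0)).
apply: (@le_trans _ _ ((4 * B) ^ L)%:R); last first.
  by have := s0P s (ltnW les); rewrite mulrAC.
have E : ((1 - q) ^+ s * (s%:R * q)) ^+ J <= 1.
  apply: exprn_ile1; last by rewrite expr_1B_leq // ltW.
  by rewrite !mulr_ge0 ?exprn_ge0 ?ler0n // ltW.
apply: (@le_trans _ _ (((4 * B) ^ L)%:R * ((1 - q) ^+ s * (s%:R * q)) ^+ J)); last first.
  by rewrite ler_piMr ?ler0n.
rewrite !exprMn -exprM.
apply: (@le_trans _ _ (((4 * B) ^ L * s ^ (2 * L))%:R * (1 - q) ^+ (s * J) * s%:R * q ^+ J)).
  by rewrite !ler_wpM2r ?exprn_ge0 ?ler_nat ?ler0n // ltW.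
rewrite natrM natrX /J [s%:R ^+ _]exprD expr1.
by rewrite le_eqVlt; apply/orP; left; apply/eqP; rewrite natrX; ring.
Qed.

End Asymptotics.

Lemma prob_or (R : realFieldType) (p : R) (T : finType) (B : {set T}) (P Q : pred {set T}) :
  0 <= p -> p <= 1 -> prob p B (fun G => P G || Q G) <= prob p B P + prob p B Q.
Proof.
move=> p0 p1; have := prob_exists p0 p1 xpredT B (fun b : bool => if b then P else Q).
rewrite big_bool; apply: le_trans; apply: prob_mono => // G _ PQ.
by apply/existsP; case/orP: PQ => h; [exists true | exists false].
Qed.

Lemma core_clique_rich_whp (R : archiRealFieldType) (p : R) (k L m D : nat) (eta : R) :
    0 < p < 1 -> (0 < m)%N -> (0 < D)%N -> 0 < eta ->
  exists n0, forall n, (n0 <= n)%N -> exists2 K : {set 'I_n},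
    (D * #|K| ^ 2 <= n)%N &
    1 - eta <= prob p (complete_graph 'I_n) (fun G => core G K k L && clique_rich G m D).
Proof.
move=> /andP[p_gt0 p_lt1] m_gt0 D_gt0 eta_gt0.
have [p_ge0 p_le1] : 0 <= p /\ p <= 1 by split; apply: ltW.
have eta2 : 0 < eta / 2 by rewrite divr_gt0.
have pM M : 0 < p ^+ M <= 1 by rewrite exprn_gt0 // exprn_ile1.
(* The core has c s vertices with D (c s)^2 <= n: it is small enough for its
   edges to be negligible, and holds s (2 L + 1) disjoint k-sets away from any X. *)
pose c := (k * (2 * L + 1) + L + 1)%N; pose B := (D * c ^ 2)%N.
have B_gt0 : (0 < B)%N by rewrite muln_gt0 D_gt0 expn_gt0 /c; lia.
have [s0 s0P] := core_rate L B (pM (2 ^ (L + k))%N) eta2.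
have DM : (0 < D * m ^ 2)%N by rewrite muln_gt0 D_gt0 expn_gt0 m_gt0.
have [n1 n1P] := clique_rich_rate (pM (2 ^ m)%N) eta2 DM.
exists (n1 + B * s0.+2 ^ 2)%N => n len.
have [s /andP[les lts]] := nat_sqrt_between n B_gt0.
have s0s : (s0 < s)%N.
  rewrite ltnNge; apply/negP => sle.
  have : (B * s.+1 ^ 2 <= B * s0.+2 ^ 2)%N by rewrite leq_pmul2l // leq_exp2r //; lia.
  lia.
have csn : (D * (c * s) ^ 2 <= n)%N by apply: leq_trans les; rewrite /B expnMn mulnA.
pose K := [set x in take (c * s) (enum 'I_n)].
have cK : #|K| = (c * s)%N.
  rewrite cardsE (card_uniqP _) ?take_uniq ?enum_uniq // size_takel //.
  by rewrite size_enum_ord (leq_trans (leq_pmul_sqr _ D_gt0)).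
exists K; first by rewrite cK.
have f1 := @prob_not_core R p 'I_n p_ge0 p_le1 K k L (s * (2 * L + 1)).
have f2 := @prob_not_clique_rich R p 'I_n p_ge0 p_le1 m D (n %/ (D * m ^ 2)) m_gt0 D_gt0.
rewrite card_ord in f1 f2.
have {}f1 := le_trans (f1 _) (s0P s n _ _).
have {}f2 := le_trans (f2 _) (n1P n _).
rewrite lerBlDr -lerBlDl -(prob_not p).
apply: (@le_trans _ _ (eta / 2 + eta / 2)); last by rewrite -splitr.
apply: (@le_trans _ _ (prob p (complete_graph 'I_n)
   (fun G => ~~ core G K k L || ~~ clique_rich G m D))).
  by apply: prob_mono => // G _; rewrite negb_and.
apply: le_trans (prob_or _ _ _ p_ge0 p_le1) _; apply: lerD.
  apply: f1 => //; last exact: ltnW.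
  have s_gt0 : (0 < s)%N by apply: leq_ltn_trans s0s.
  rewrite cK /c !mulnDl mul1n mulnC mulnA mulnAC.
  by rewrite -addnA leq_add2l (leq_trans _ (leq_addr _ _)) // leq_pmulr.
apply: f2; last by lia.
by rewrite mulnA mulnC; apply: leq_trunc_div.
Qed.

(** * The weak saturation number of a random graph *)

Import all_classical all_reals all_analysis.
Import numFieldNormedType.Exports.
Local Open Scope classical_set_scope.
Local Open Scope ring_scope.

Theorem theorem1p3 (R : realType) (W : finType) (F : {set {set W}}) (p : R)
  (F_simple : simple_graph F) (F_mindeg : (1 <= min_degree F)%N)
  (p_gt0 : 0 < p) (p_lt1 : p < 1) :
  forall eps : R, 0 < eps ->
    gnp_prob p (fun G : {set {set 'I_n}} =>
      `|(wsat F G)%:R - (wsat_complete n F)%:R|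
        <= eps * (wsat_complete n F)%:R) @[n --> \oo] --> (1 : R).
Proof.
move=> eps eps_gt0; have [p_ge0 p_le1] : 0 <= p /\ p <= 1 by split; apply: ltW.
have [s0 s0P] := eventually_large 8 eps_gt0.
have [L [m [D [n0 [m_gt0 D_gt0 det]]]]] :=
  wsat_core_clique_rich F_simple F_mindeg (ltn0Sn s0).
apply/cvgrPdist_le => /= eta eta_gt0.
have p01 : 0 < p < 1 by rewrite p_gt0.
have [n1 n1P] := core_clique_rich_whp #|W| L p01 m_gt0 D_gt0 eta_gt0.
exists (maxn n0 n1) => // n /=; rewrite geq_max => /andP[n0n n1n].
have [K cK whp] := n1P n n1n.
rewrite -[gnp_prob _ _]/(prob p (complete_graph 'I_n) _).
rewrite ger0_norm ?subr_ge0 ?prob_le1 // lerBlDr -lerBlDl.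
apply: le_trans whp _; apply: prob_mono => // G sG /andP[cG dG].
have [low up] := det n K G n0n sG cK cG dG.
rewrite ger0_norm ?subr_ge0 ?ler_nat //.
have D0 : 0 < s0.+1%:R :> R by rewrite ltr0n.
rewrite -(ler_pM2l D0); move: up; rewrite -(ler_nat R) !natrM natrD => up.
have := ler_wpM2r (ler0n R (wsat_complete n F)) (s0P s0.+1 (leqnSn _)); lra.
Qed.
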